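(* Let $B$ be a board that is a sub-board of some parallelogram board (i.e. $B$ is, up to a symmetry of the hexagonal tessellation, a subset of some $P(m_1,m_2)$). Then $B$ with exactly two holes has the weak parity property. Hence each of the following boards, with exactly two holes, has the weak parity property: the parallelograms $P(m_1,m_2)$, the triangles $T(m)$, the flowers $F(m)$, the trimmed parallelograms $P^{tr}(m_1,m_2)$ with $m_1,m_2\ge3$, and the trimmed triangles $T^{tr}(m)$ with $m\ge4$.
   Context: Hexagons of the regular hexagonal tessellation of the plane are identified with points of $\mathbb{Z}^2$; two hexagons are adjacent (share an edge) iff their difference is one of $\pm(1,0),\pm(0,1),\pm(1,1)$. A board $B$ is a finite set of hexagons (positions). Families of boards: parallelogram $P(m_1,m_2)=\{0,\dots,m_1-1\}\times\{0,\dots,m_2-1\}$; triangle with $m$ hexagons on a side $T(m)=\{(i,j): 0\le j\le i\le m-1\}$; flower with $m$ layers $F(m)=\{(i,j):\max(|i|,|j|,|i-j|)\le m-1\}$. A tight corner of a board is a hexagon of the board with exactly two neighbors in the board, which are adjacent to each other; $P^{tr}(m_1,m_2)$ and $T^{tr}(m)$ are obtained from $P(m_1,m_2)$ and $T(m)$ by removing all tight corners (two acute corners, resp. three corners). $B(h)$ denotes the board $B$ with $h$ holes, where $h<|B|$: a configuration of $B(h)$ is a placement of $t=|B|-h$ tiles with distinct labels $1,\dots,t$ on distinct positions of $B$; the $h$ unoccupied positions are the holes (unlabeled; adjacent holes are counted separately). A slide moves a tile from its position $p$ to a hole $q$ adjacent to $p$, and is permitted iff there is another hole $r$ that is adjacent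 to both $p$ and $q$. The puzzle graph $puz[B(h)]$ has the configurations of $B(h)$ as vertices, with an edge between two configurations whenever one can be obtained from the other by one slide. A configuration is non-isolated if at least one slide is possible from it. $B(h)$ has the weak parity property if whenever two non-isolated configurations with the holes in the same positions are in the same connected component of $puz[B(h)]$, one can be obtained from the other by an even permutation of the tiles. *)

(* Defs.v *)
(* Plain MathComp, with mathcomp-finmap for finite sets of positions. *)
From mathcomp Require Import all_boot all_order all_algebra all_fingroup.
From mathcomp Require Import finmap zify.

Set Implicit Arguments.
Unset Strict Implicit.
Unset Printing Implicit Defensive.

Import Order.TTheory GRing.Theory Num.Theory.
Local Open Scope fset_scope.
Local Open Scope ring_scope.

Definition position := (int * int)%type.
Definition board := {fset position}.

Definition adj (p q : position) : bool :=
  q - p \in [:: (1, 0); (-1, 0); (0, 1); (0, -1); (1, 1); (-1, -1)].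

(* The symmetries of the tessellation act on hexagons as the automorphisms
   of the adjacency graph. *)
Definition hex_symmetry (f : position -> position) : Prop :=
  bijective f /\ forall p q, adj (f p) (f q) = adj p q.

Definition parallelogram (m1 m2 : nat) : board :=
  [fset ((i%:Z, j%:Z) : position) | i in iota 0 m1, j in iota 0 m2].

Definition triangle (m : nat) : board :=
  [fset x in parallelogram m m | x.2 <= x.1].

(* The parallelogram centred at the origin only supplies a finite range
   containing all the solutions; see [in_flower]. *)
Definition flower (m : nat) : board :=
  [fset x in [fset y - (m%:Z, m%:Z) | y in parallelogram m.*2 m.*2]
     | Num.max `|x.1| (Num.max `|x.2| `|x.1 - x.2|) <= m%:Z - 1].

Lemma in_parallelogram m1 m2 (i j : int) :
  ((i, j) \in parallelogram m1 m2) = (0 <= i < m1%:Z) && (0 <= j < m2%:Z).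
Proof.
apply/idP/idP => [/imfset2P[a + [b + [-> ->]]]|].
  by rewrite /= !mem_iota => ha hb; lia.
case: i => i; case: j => j; rewrite ?andbF ?andFb // => h.
by apply/imfset2P; exists i; [|exists j]; rewrite /= ?mem_iota //; lia.
Qed.

Lemma in_triangle m (i j : int) :
  ((i, j) \in triangle m) = (0 <= j <= i) && (i <= m%:Z - 1).
Proof. rewrite !inE in_parallelogram /=; lia. Qed.

Lemma in_flower m (i j : int) :
  ((i, j) \in flower m) =
  (Num.max `|i| (Num.max `|j| `|i - j|) <= m%:Z - 1).
Proof.
rewrite !inE /=; apply: andb_idl; rewrite !ge_max => h.
apply/imfsetP; exists ((i + m%:Z, j + m%:Z) : position).
  by rewrite /= in_parallelogram; lia.
by congr pair; rewrite /= addrK.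
Qed.

Definition neighbors (B : board) (p : position) : {fset position} :=
  [fset q in B | adj p q].

Definition tight_corner (B : board) (p : position) : bool :=
  [&& p \in B, #|` neighbors B p| == 2%N
    & [forall q : neighbors B p, forall r : neighbors B p,
         (q != r) ==> adj (val q) (val r)]].

Definition trim (B : board) : board := [fset p in B | ~~ tight_corner B p].

(* Configurations of B(h) map each tile to its position; meaningful for
   h < #|` B|, as the subtraction is truncated. *)
Definition tile (B : board) (h : nat) := 'I_(#|` B| - h).

Definition config (B : board) (h : nat) :=
  {c : {ffun tile B h -> B} | injectiveb c}.

Section Puzzle.
Variables (B : board) (h : nat).
Implicit Types c d : config B h.

Definition hole c (q : B) : bool := q \notin codom (val c).

Definition slide c d : bool :=
  [exists t : tile B h, exists q : B, exists r : B,
    [&& hole c q, hole c r, r != q,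
        adj (val (val c t)) (val q),
        adj (val r) (val (val c t)), adj (val r) (val q)
      & val d == [ffun s => if s == t then q else val c s]]].

Definition puz : rel (config B h) := fun c d => slide c d || slide d c.

Definition non_isolated c : bool := [exists d, slide c d].

Definition weak_parity : Prop :=
  forall c d, non_isolated c -> non_isolated d ->
    hole c =1 hole d -> connect puz c d ->
    exists s : {perm tile B h}, ~~ odd_perm s /\ forall t, val d t = val c (s t).

End Puzzle.

Definition subboard_of_parallelogram (B : board) : Prop :=
  exists (f : position -> position) (m1 m2 : nat),
    hex_symmetry f /\ [fset f p | p in B] `<=` parallelogram m1 m2.

(* Main.v *)
Require Import Defs.
From mathcomp Require Import all_boot all_order all_algebra all_fingroup.
From mathcomp Require Import finmap.
From mathcomp Require Import zify.

(** The weak parity property with two holes holds on every board.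

    Colour the hexagon (i, j) with i + j modulo 3.  Adjacent hexagons get
    different colours, so three mutually adjacent hexagons carry all three
    colours, and an ordered pair of adjacent hexagons is oriented according to
    whether the colour increases or decreases by 1 ([ascends]).

    With two holes a slide involves a triangle p, q, r: a tile moves from p to
    the hole q while r is the other hole.  Viewed as a permutation of the
    board, it is the transposition of p and q, and it moves one of the two
    holes to the hexagon of the third colour.  Hence it changes both the sign
    of the permutation of the board and the orientation of the (labelled) pair
    of holes ([ascends_triangle]).  Along a sequence of slides these two signs
    therefore stay equal ([connect_tracks]).

    When the holes return to the positions that they occupied at the start,
    either each hole is back, and the permutation of the board is even, or the
    two holes are exchanged, and it is odd; in the second case composing with
    the transposition of the holes makes it even.  Either way an even
    permutation of the board that fixes both holes carries the first
    configuration to the second, and its restriction to the tiles has the same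
    sign ([extend_perm]). *)

Set Implicit Arguments.
Unset Strict Implicit.
Unset Printing Implicit Defensive.

Local Open Scope fset_scope.

(** * Adjacency and the three-colouring *)

(** For adjacent hexagons this says that the colour i + j, modulo 3,
    increases by 1 from [p] to [q]: the listed differences are the three
    directions whose coordinate sum is 1 modulo 3. *)
Definition ascends (p q : position) : bool :=
  (q - p \in [:: (1, 0); (0, 1); (-1, -1)])%R.

Lemma adj_sym p q : adj p q = adj q p.
Proof.
case: p q => [a b] [c d].
by rewrite /adj !inE /= !xpair_eqE /=; apply/idP/idP; lia.
Qed.

Lemma ascends_sym p q : adj p q -> ascends q p = ~~ ascends p q.
Proof.
case: p q => [a b] [c d].
rewrite /adj /ascends !inE /= !xpair_eqE /= => h; lia.
Qed.

(** The hexagons [p] and [q] have the two colours different from that of [r],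
    so one is a colour step above [r] and the other a step below. *)
Lemma ascends_triangle p q r : adj p q -> adj r p -> adj r q ->
  ascends r p = ~~ ascends r q.
Proof.
case: p q r => [a b] [c d] [e f].
rewrite /adj /ascends !inE /= !xpair_eqE /=.
(* Fixing the first two differences leaves a linear problem in each of the
   36 cases. *)
by do 2![case/or4P=> [|||/or3P[]] /andP[/eqP ? /eqP ?]]; lia.
Qed.

(** * Signs of permutations along an injection *)

(** The sign of a permutation is preserved when it is transported along an
    injection and completed by the identity, because transpositions are
    transported to transpositions. *)
Lemma extend_perm (T U : finType) (f : T -> U) (s : {perm T}) :
  injective f ->
  exists u : {perm U}, [/\ odd_perm u = odd_perm s,
    forall t, u (f t) = f (s t) & forall x, x \notin codom f -> u x = x].
Proof.
move=> f_inj; case: (prod_tpermP s) => ts -> {s}.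
elim: ts => [|[x y] ts IH] /=.
  by exists 1%g; split=> [|t|z _]; rewrite ?big_nil ?odd_perm1 ?perm1.
case/andP=> neq_xy /IH[u [u_odd u_f u_fix]]; rewrite big_cons /=.
exists (tperm (f x) (f y) * u)%g; split=> [|t|z z_f].
- by rewrite !odd_permM u_odd !odd_tperm (inj_eq f_inj).
- by rewrite !permM -inj_tperm // u_f.
- rewrite permM tpermD ?u_fix //; apply: contraNneq z_f => <-; exact: codom_f.
Qed.

(** * Slides with two holes *)

Section TwoHoles.
Variable B : board.
Implicit Types c d e : config B 2.

Lemma hole_tile c t : hole c (val c t) = false.
Proof. by rewrite /hole codom_f. Qed.

Lemma hole_neq_tile c t x : hole c x -> (val c t == x) = false.
Proof. by move=> x_c; apply/eqP => tx; rewrite -tx hole_tile in x_c. Qed.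

(** The tile [t] ensures that the board has more than two hexagons, so that
    the truncated subtraction counting the tiles leaves exactly two holes. *)
Lemma holesP c (t : tile B 2) :
  exists x y, [/\ x != y, hole c x, hole c y &
                  forall z, hole c z -> z = x \/ z = y].
Proof.
have tile_gt0 : (0 < #|` B| - 2)%N by case: t => i /=; apply: leq_ltn_trans.
have : #|[set x | hole c x]| == 2%N.
  have <- : #|[predC codom (val c)]| = #|[set x | hole c x]|.
    by apply: eq_card => x; rewrite !inE.
  have := cardC (mem (codom (val c))).
  rewrite card_codom ?card_ord -?cardfE; last exact/injectiveP/(valP c).
  move=> card_B; apply/eqP/(@addnI (#|` B| - 2)); rewrite subnK; last by lia.
  exact: card_B.
case/cards2P=> x [y [neq_xy E]]; exists x, y.
have H z : hole c z = (z \in [set x; y]) by rewrite -E inE.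
by split=> // [||z]; rewrite H !inE ?eqxx ?orbT // => /orP[] /eqP; auto.
Qed.

Lemma slide_sym c d : slide c d -> slide d c.
Proof.
case/existsP=> t /existsP[q /existsP[r /and5P[q_c r_c neq_rq pq /and3P[rp rq]]]].
move/eqP=> def_d.
have c_inj : injective (val c) by apply/injectiveP/(valP c).
have d_t : val d t = q by rewrite def_d ffunE eqxx.
apply/existsP; exists t; apply/existsP; exists (val c t).
apply/existsP; exists r; rewrite d_t rp rq adj_sym pq /=.
rewrite eq_sym hole_neq_tile //=; apply/and3P; split.
- apply/codomP => -[s]; rewrite def_d ffunE; case: ifP => [_|neq_st].
    by move=> tq; move: q_c; rewrite -tq hole_tile.
  by move/c_inj => ts; rewrite ts eqxx in neq_st.
- apply/codomP => -[s]; rewrite def_d ffunE; case: ifP => [_ rqE|_ rs].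
    by rewrite rqE eqxx in neq_rq.
  by move: r_c; rewrite rs hole_tile.
- apply/eqP/ffunP => s; rewrite ffunE.
  by case: eqP => [->//|/eqP/negbTE neq_st]; rewrite def_d ffunE neq_st.
Qed.

(** The tiles determine [u] only up to an exchange of the two holes; choosing
    [u] amounts to labelling the holes.  The condition on the sign is the
    invariant of sequences of slides. *)
Definition tracks c d (u : {perm B}) : Prop :=
  (forall t, u (val c t) = val d t) /\
  forall x y, hole c x -> hole c y -> x != y ->
    odd_perm u = ascends (val x) (val y) (+) ascends (val (u x)) (val (u y)).

Lemma hole_tracks c d (u : {perm B}) x :
  (forall t, u (val c t) = val d t) -> hole c x -> hole d (u x).
Proof.
move=> u_cd; apply: contraNN => /codomP[t]; rewrite -u_cd => /perm_inj ->.
exact: codom_f.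
Qed.

Lemma slide_tracks c d e u :
  tracks c d u -> slide d e -> exists v, tracks c e v.
Proof.
case=> u_cd u_odd.
case/existsP=> t /existsP[q /existsP[r /and5P[q_d r_d neq_rq pq /and3P[rp rq]]]].
move/eqP=> def_e; set p := val d t in pq rp.
have d_inj : injective (val d) by apply/injectiveP/(valP d).
have neq_pq : p != q by rewrite hole_neq_tile.
have tperm_r : tperm p q r = r.
  by rewrite tpermD // ?hole_neq_tile // eq_sym.
have rpq : ascends (val r) (val p) = ~~ ascends (val r) (val q).
  exact: ascends_triangle.
have prq : ascends (val p) (val r) = ~~ ascends (val q) (val r).
  by rewrite (ascends_sym rp) rpq (ascends_sym rq).
(* The unordered pair of holes of [d] is {q, r}; in either labelling, the hole
   at [q] moves to [p] and the other one stays. *)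
have qr_holes z : hole d z -> z = q \/ z = r.
  have [x [y [neq_xy _ _ xy]]] := holesP d t.
  move=> /xy; case: (xy _ q_d) (xy _ r_d) neq_rq => -> [] -> //;
    rewrite ?eqxx //; tauto.
exists (u * tperm p q)%g; split=> [s|x y x_c y_c neq_xy].
  rewrite permM u_cd def_e ffunE; case: eqP => [->|/eqP neq_st].
    exact: tpermL.
  by rewrite tpermD // ?(inj_eq d_inj) 1?eq_sym // hole_neq_tile.
rewrite odd_permM odd_tperm neq_pq (u_odd x y) // !permM.
have neq_uxy : u x != u y by rewrite (inj_eq perm_inj).
case: (qr_holes _ (hole_tracks u_cd x_c)) (qr_holes _ (hole_tracks u_cd y_c))
  neq_uxy => -> [] ->; rewrite ?eqxx // => _; rewrite tpermR tperm_r.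
  by rewrite prq addbN addbT.
by rewrite rpq addbN addbT.
Qed.

Lemma connect_tracks c d : connect (@puz B 2) c d -> exists u, tracks c d u.
Proof.
case/connectP=> s; elim/last_ind: s d => [|s e IH] d /=.
  move=> _ ->; exists 1%g; split=> [t|x y _ _ _]; rewrite ?perm1 //.
  by rewrite odd_perm1 addbb.
rewrite rcons_path last_rcons => /andP[/IH/(_ erefl)[u u_tracks] step ->].
by case/orP: step => [|/slide_sym]; apply: slide_tracks u_tracks.
Qed.

(** The existence of a slide is used to know that the two holes of [c] are
    adjacent, so that exchanging them reverses their orientation. *)
Lemma tracks_even c d u : non_isolated c -> hole c =1 hole d -> tracks c d u ->
  exists v : {perm B}, [/\ ~~ odd_perm v,
    forall t, v (val c t) = val d t & forall x, hole c x -> v x = x].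
Proof.
case/existsP=> e /existsP[t /existsP[x /existsP[y]]].
case/and5P=> x_c y_c neq_yx _ /and3P[_ adj_yx _] eq_cd [u_cd u_odd].
have [a [b [neq_ab _ _ ab]]] := holesP c t.
have xy_holes z : hole c z -> z = x \/ z = y.
  move=> /ab; case: (ab _ x_c) (ab _ y_c) neq_yx => -> [] -> //;
    rewrite ?eqxx //; tauto.
have u_hole z : hole c z -> u z = x \/ u z = y.
  by move=> /(hole_tracks u_cd); rewrite -eq_cd => /xy_holes.
have neq_uyx : u y != u x by rewrite (inj_eq perm_inj).
have odd_u := u_odd _ _ y_c x_c neq_yx.
case: (u_hole _ x_c) (u_hole _ y_c) neq_uyx odd_u => ux [] uy;
  rewrite ux uy ?eqxx // => _.
  (* Both holes are back in place. *)
  rewrite addbb => odd_u; exists u; split; rewrite ?odd_u //.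
  by move=> z /xy_holes[] ->.
(* The holes are exchanged. *)
rewrite (ascends_sym adj_yx) addbN addbb => odd_u.
exists (u * tperm x y)%g; split=> [|s|z /xy_holes[] ->].
- by rewrite odd_permM odd_tperm odd_u eq_sym neq_yx.
- by rewrite permM u_cd tpermD // eq_sym hole_neq_tile // -eq_cd.
- by rewrite permM ux tpermR.
- by rewrite permM uy tpermL.
Qed.

Lemma same_holes_perm c d : hole c =1 hole d ->
  exists s : {perm tile B 2}, forall t, val d t = val c (s t).
Proof.
move=> eq_cd.
have d_c t : val d t \in codom (val c).
  by have := hole_tile d t; rewrite -eq_cd => /negbFE.
have s_inj : injective (fun t => iinv (d_c t)).
  move=> t1 t2 /(congr1 (val c)); rewrite !f_iinv.
  exact: (injectiveP _ (valP d)).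
by exists (perm s_inj) => t; rewrite permE f_iinv.
Qed.

Theorem weak_parity_two_holes : weak_parity B 2.
Proof.
move=> c d c_moves _ eq_cd /connect_tracks[u u_tracks].
have [v [v_even v_cd v_fix]] := tracks_even c_moves eq_cd u_tracks.
have [s d_cs] := same_holes_perm eq_cd.
have [w [w_odd w_c w_fix]] := extend_perm s (injectiveP _ (valP c)).
exists s; split=> //; rewrite -w_odd.
(* Both fix the holes and carry each tile from [c] to [d]. *)
suff -> : w = v by [].
apply/permP => x; have [/codomP[t ->]|x_c] := boolP (x \in codom (val c)).
  by rewrite w_c -d_cs v_cd.
by rewrite w_fix // v_fix.
Qed.

End TwoHoles.

Theorem corollary1p6 :
  (forall B : board, subboard_of_parallelogram B ->
     (2 < #|` B|)%N -> weak_parity B 2) /\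
  (forall m1 m2 : nat, (2 < #|` parallelogram m1 m2|)%N ->
     weak_parity (parallelogram m1 m2) 2) /\
  (forall m : nat, (2 < #|` triangle m|)%N -> weak_parity (triangle m) 2) /\
  (forall m : nat, (2 < #|` flower m|)%N -> weak_parity (flower m) 2) /\
  (forall m1 m2 : nat, (3 <= m1)%N -> (3 <= m2)%N ->
     weak_parity (trim (parallelogram m1 m2)) 2) /\
  (forall m : nat, (4 <= m)%N -> weak_parity (trim (triangle m)) 2).
Proof.
by do ![split] => *; apply: weak_parity_two_holes.
Qed.
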